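(* Let all random vectors below be infinitely divisible, centered, and with finite second moments. 1. If $X$ is such a vector in $\mathbb{R}^d$ and $L:\mathbb{R}^d\to\mathbb{R}^m$ is linear, then $C_{LX}(t)=C_X(L^\top t)$ for every $t\in\mathbb{R}^m$. 2. If $X$ and $Y$ are independent such vectors in $\mathbb{R}^d$, then $C_{X+Y}(t)\le\max\{C_X(t),C_Y(t)\}$ for every $t\in\mathbb{R}^d$. 3. If $(L_r)_{r\ge0}$ is a centered Lévy process in $\mathbb{R}^d$ with finite second moments, then for every $r>0$ and every $t\in\mathbb{R}^d$, $C_{L_r}(t)=C_{L_1}(t)$.
   Context: For a centered infinitely divisible random vector $X$ in $\mathbb{R}^d$ with finite second moment and covariance matrix $\Sigma$, put $K_X(t):=\log\mathbb{E}e^{\langle t,X\rangle}$ (value $+\infty$ allowed) and $V_X(t):=t^\top\Sigma t$. Directional (radial) pole: if $V_X(t)>0$, $C_X(t)\in[0,\infty]$ is the infimum of all $c\in[0,\infty)$ such that $$K_X(st)\le\frac{V_X(t)s^2}{2(1-cs)}\qquad\text{for all }0\le s<1/c,$$ with $1/0=\infty$ and $\inf\emptyset=\infty$. If $V_X(t)=0$, $C_X(t):=0$. *)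

(* Defs.v *)
From HB Require Import structures.
From mathcomp Require Import all_boot all_order all_algebra.
From mathcomp Require Import all_classical all_reals all_analysis.

Set Implicit Arguments.
Unset Strict Implicit.
Unset Printing Implicit Defensive.

Import Order.TTheory GRing.Theory Num.Theory.
Import numFieldNormedType.Exports.

Local Open Scope classical_set_scope.
Local Open Scope ring_scope.

(* R^d is the type of column vectors 'cV[R]_d; borel_cV R d is the same carrier
   equipped with the sigma-algebra generated by the open sets. *)
Definition borel_cV (R : realType) (d : nat) :=
  g_sigma_algebraType (@open 'cV[R]_d).

Section RandomVectors.
Context (R : realType) (d : nat).

Definition random_vector dT (T : measurableType dT) (X : T -> 'cV[R]_d) :=
  measurable_fun [set: T] (X : T -> borel_cV R d).

Definition same_law dT (T : measurableType dT) (P : probability T R)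
    dT' (T' : measurableType dT') (P' : probability T' R)
    (X : T -> 'cV[R]_d) (Y : T' -> 'cV[R]_d) :=
  forall A : set (borel_cV R d), measurable A ->
    P (X @^-1` A) = P' (Y @^-1` A).

Section OneSpace.
Context dT (T : measurableType dT) (P : probability T R).

Definition independent_vectors (X Y : T -> 'cV[R]_d) :=
  forall A B : set (borel_cV R d), measurable A -> measurable B ->
    P (X @^-1` A `&` Y @^-1` B) = (P (X @^-1` A) * P (Y @^-1` B))%E.

(* Taking some of the A i to be setT yields the product rule for subfamilies. *)
Definition independent_family (n : nat) (X : 'I_n -> T -> 'cV[R]_d) :=
  forall A : 'I_n -> set (borel_cV R d), (forall i, measurable (A i)) ->
    P (\bigcap_(i in [set: 'I_n]) (X i @^-1` A i)) =
    (\prod_(i < n) P (X i @^-1` A i))%E.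

Definition centered (X : T -> 'cV[R]_d) :=
  forall i : 'I_d, ('E_P[fun w => X w i 0%R] = 0)%E.

(* E |X|^2 < oo for the Euclidean norm (the library norm on matrices is the
   sup norm). *)
Definition finite_second_moment (X : T -> 'cV[R]_d) :=
  ('E_P[fun w => (\sum_(i < d) X w i 0 ^+ 2)%R] < +oo)%E.

Definition covariance_matrix (X : T -> 'cV[R]_d) : 'M[R]_d :=
  \matrix_(i, j) fine (covariance P (fun w => X w i 0) (fun w => X w j 0)).

Definition inner (t x : 'cV[R]_d) : R := (t^T *m x) 0 0.

Definition cgf (X : T -> 'cV[R]_d) (t : 'cV[R]_d) : \bar R :=
  lne ('E_P[fun w => expR (inner t (X w))])%E.

Definition directional_variance (X : T -> 'cV[R]_d) (t : 'cV[R]_d) : R :=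
  (t^T *m covariance_matrix X *m t) 0 0.

(* The extended inverse satisfies (0%:E)^-1 = +oo. *)
Definition radial_bound (X : T -> 'cV[R]_d) (t : 'cV[R]_d) (c : R) :=
  forall s : R, 0 <= s -> (s%:E < (c%:E)^-1)%E ->
    (cgf X (s *: t) <=
     (directional_variance X t * s ^+ 2 / (2 * (1 - c * s)))%:E)%E.

Definition radial_pole (X : T -> 'cV[R]_d) (t : 'cV[R]_d) : \bar R :=
  if 0 < directional_variance X t then
    ereal_inf [set c%:E | c in [set c : R | 0 <= c /\ radial_bound X t c]]
  else 0%E.

End OneSpace.

(* Divisibility is a property of the law of X: the n independent summands may
   live on another probability space. *)
Definition infinitely_divisible dT (T : measurableType dT)
    (P : probability T R) (X : T -> 'cV[R]_d) :=
  forall n : nat, (0 < n)%N ->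
  exists dT' (T' : measurableType dT') (P' : probability T' R)
    (Y : 'I_n -> T' -> 'cV[R]_d),
    [/\ forall i, random_vector (Y i), independent_family P' Y,
        forall i j, same_law P' P' (Y i) (Y j)
      & same_law P P' X (fun w => \sum_(i < n) Y i w)].

Section Processes.
Context dT (T : measurableType dT) (P : probability T R).

Definition centered_id_vector (X : T -> 'cV[R]_d) :=
  [/\ random_vector X, infinitely_divisible P X, centered P X
    & finite_second_moment P X].

(* Only the values L r with 0 <= r are constrained. *)
Record levy_process (L : R -> T -> 'cV[R]_d) : Prop := LevyProcess {
  levy_random_vector : forall r : R, 0 <= r -> random_vector (L r) ;
  levy_start : {ae P, forall w, L 0 w = 0} ;
  levy_independent_increments : forall (n : nat) (r : nat -> R),
    0 <= r 0%N -> (forall i, (i < n)%N -> r i < r i.+1) ->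
    independent_family P (fun (i : 'I_n) w => L (r i.+1) w - L (r i) w) ;
  levy_stationary_increments : forall s r : R, 0 <= s -> 0 <= r ->
    same_law P P (fun w => L (s + r) w - L s w) (L r) ;
  levy_stochastic_continuity : forall s eps : R, 0 <= s -> 0 < eps ->
    P [set w | eps < `|L r w - L s w|]
      @[r --> within [set r : R | 0 <= r] (nbhs s)] --> 0%E ;
  levy_cadlag : {ae P, forall w,
    (forall r : R, 0 <= r -> L q w @[q --> r^'+] --> L r w) /\
    (forall r : R, 0 < r -> cvg (L q w @[q --> r^'-]))}
}.

End Processes.
End RandomVectors.

(* Main.v *)
(* Everything is read off the scalars <t,X>, which are centered and square
   integrable. The variance is then V_X(t) = E <t,X>^2, and Jensen's inequality
   gives K_X >= 0. If V_X(t) = 0 then <t,X> = 0 a.s., so c = 0 is admissible and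
   the pole is the infimum of the admissible constants in all cases;
   admissibility is monotone in c. For independent X and Y both K and V add up,
   so max(a, b) is admissible for X + Y as soon as a is for X and b is for Y.
   For a Levy process, r |-> K_{L_r}(u) and r |-> V_{L_r}(t) are additive and
   nonnegative, hence monotone, hence linear in r (Cauchy's equation; infinite
   values are allowed), so both sides of the bound scale by r. *)
From HB Require Import structures.
Require Import Defs.
From mathcomp Require Import all_boot all_order all_algebra.
From mathcomp Require Import all_classical all_reals all_analysis.
From mathcomp Require Import measurable_realfun ring lra.

Set Implicit Arguments.
Unset Strict Implicit.
Unset Printing Implicit Defensive.

Import Order.TTheory GRing.Theory Num.Theory.
Import numFieldNormedType.Exports.

Local Open Scope classical_set_scope.
Local Open Scope ring_scope.

(** * Centered square-integrable real random variables *)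

Section Scalars.
Context (R : realType) dT (T : measurableType dT) (P : probability T R).

Definition centered_L2 (Z : T -> R) :=
  Z \in Lfun P 2%:E /\ ('E_P[Z] = 0)%E.

Lemma L2_measurable (Z : T -> R) : Z \in Lfun P 2%:E -> measurable_fun setT Z.
Proof. by rewrite inE => /andP[/[!inE]]. Qed.

Lemma L2_L1 (Z : T -> R) : Z \in Lfun P 2%:E -> Z \in Lfun P 1.
Proof. by apply: Lfun_subset12; exact: fin_num_measure. Qed.

Lemma LfunD (p : \bar R) (U V : T -> R) : (1 <= p)%E ->
  U \in Lfun P p -> V \in Lfun P p -> U \+ V \in Lfun P p.
Proof. by move=> p1 U2 V2; rewrite rpredD. Qed.

Lemma centered_L2D (U V : T -> R) :
  centered_L2 U -> centered_L2 V -> centered_L2 (fun w => U w + V w).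
Proof.
move=> [U2 U0] [V2 V0]; split.
  by apply: (@LfunD _ U V); rewrite ?lee1n.
by rewrite expectationD ?L2_L1// U0 V0 adde0.
Qed.

Lemma centered_L2Z (a : R) (U : T -> R) :
  centered_L2 U -> centered_L2 (fun w => a * U w).
Proof.
move=> [U2 U0].
have -> : (fun w => a * U w) = a \o* U by apply/funext => w /=; rewrite mulrC.
split; first by apply: Lfun_scale => //; rewrite ler1n.
by rewrite expectationZl ?L2_L1// U0 mule0.
Qed.

Lemma centered_L2_0 : centered_L2 (fun=> 0).
Proof. by split; [exact: Lfun_cst|rewrite expectation_cst]. Qed.

Lemma centered_L2_sum (n : nat) (a : 'I_n -> R) (U : 'I_n -> T -> R) :
  (forall i, centered_L2 (U i)) ->
  centered_L2 (fun w => \sum_(i < n) a i * U i w).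
Proof.
(* The sum over ['I_n] is generalized to an arbitrary list of indices, which makes induction
   available. *)
move=> hU; elim: (index_enum _) => [|i s IH].
  rewrite (_ : (fun _ => _) = fun=> 0); first exact: centered_L2_0.
  by apply/funext => w; rewrite big_nil.
rewrite (_ : (fun _ => _) =
    fun w => a i * U i w + \sum_(j <- s) a j * U j w); last first.
  by apply/funext => w; rewrite big_cons.
by apply: centered_L2D => //; exact: centered_L2Z.
Qed.

Lemma sqr_integrable_L2 (Z : T -> R) : measurable_fun setT Z ->
  ('E_P[fun w => (Z w ^+ 2)%R] < +oo)%E -> Z \in Lfun P 2%:E.
Proof.
move=> mZ; rewrite unlock => Z2; rewrite inE; apply/andP; split; rewrite inE//=.
rewrite /finite_norm unlock /Lnorm poweR_lty//=.
by under eq_integral => w _ do rewrite powR_mulrn// real_normK ?num_real//.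
Qed.

(** Entries of the covariance matrix are [fine] values. Nothing is lost by [fine], because the
    product of two L2 variables is integrable. *)
Lemma centered_L2_covariance (U V : T -> R) :
  centered_L2 U -> centered_L2 V ->
  ((fine (covariance P U V))%:E = 'E_P[fun w => (U w * V w)%R])%E.
Proof.
move=> [U2 U0] [V2 V0].
have UV1 := Lfun2_mul_Lfun1 U2 V2.
have -> : (covariance P U V = 'E_P[fun w => (U w * V w)%R])%E.
  by rewrite (covarianceE (L2_L1 U2) (L2_L1 V2) UV1) U0 mul0e sube0.
by rewrite fineK// expectation_fin_num.
Qed.

Lemma fine_covariance_suml (n : nat) (a : 'I_n -> R) (U : 'I_n -> T -> R)
    (V : T -> R) :
  (forall i, centered_L2 (U i)) -> centered_L2 V ->
  fine (covariance P (fun w => \sum_(i < n) a i * U i w) V) =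
  \sum_(i < n) a i * fine (covariance P (U i) V).
Proof.
move=> hU hV.
(* The induction must carry square integrability of the partial sums, since additivity of the
   covariance requires it. *)
suff [] : centered_L2 (fun w => \sum_(i < n) a i * U i w) /\
  fine (covariance P (fun w => \sum_(i < n) a i * U i w) V) =
  \sum_(i < n) a i * fine (covariance P (U i) V) by [].
elim: (index_enum _) => [|i s [cS IH]].
  rewrite big_nil (_ : (fun _ => _) = cst 0); last first.
    by apply/funext => w; rewrite big_nil.
  by split; [exact: centered_L2_0|rewrite covariance_cst_l].
rewrite (_ : (fun _ => _) =
    (a i \o* U i) \+ (fun w => \sum_(j <- s) a j * U j w)); last first.
  by apply/funext => w /=; rewrite big_cons [in RHS]mulrC.
have cU := centered_L2Z (a i) (hU i).
rewrite (_ : (fun w => a i * U i w) = a i \o* U i) in cU; last first.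
  by apply/funext => w /=; rewrite mulrC.
split; first exact: centered_L2D.
have fin (W : T -> R) : centered_L2 W -> covariance P W V \is a fin_num.
  move=> cW; apply: (covariance_fin_num (L2_L1 cW.1) (L2_L1 hV.1)).
  exact: (Lfun2_mul_Lfun1 cW.1 hV.1).
rewrite covarianceDl ?cU.1 ?cS.1 ?hV.1// fineD ?fin// IH big_cons; congr (_ + _).
rewrite (covarianceZl _ (L2_L1 (hU i).1) (L2_L1 hV.1)); last first.
  exact: (Lfun2_mul_Lfun1 (hU i).1 hV.1).
by rewrite fineM// fin.
Qed.

(** Jensen's inequality via the tangent line [1 + x <= expR x], whose left side has expectation 1 at
    a centered variable. The comparison of integrals asks for integrable functions, so an infinite
    exponential moment is treated first. *)
Lemma expectation_expR_ge1 (Z : T -> R) :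
  centered_L2 Z -> (1 <= 'E_P[fun w => expR (Z w)])%E.
Proof.
move=> [Z2 Z0].
have mE : measurable_fun setT (fun w => expR (Z w)).
  by apply: measurableT_comp => //; exact: L2_measurable.
have [Eoo|] := ltP ('E_P[fun w => expR (Z w)])%E +oo%E; last first.
  by apply: le_trans; rewrite leey.
have <- : ('E_P[fun w => (1 + Z w)%R] = 1)%E.
  by rewrite (@expectationD _ _ _ P (cst 1)) ?Lfun_cst ?L2_L1// Z0 expectation_cst
    adde0.
rewrite unlock; apply: le_integral => //.
- apply/Lfun1_integrable; apply: (@LfunD _ (cst 1) Z) => //.
  + exact: Lfun_cst.
  + exact: L2_L1.
- apply/integrableP; split; first exact/measurable_EFinP.
  move: Eoo; rewrite unlock; apply: le_lt_trans.
  by under eq_integral => w _ do rewrite gee0_abs ?lee_fin ?expR_ge0//.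
- by move=> w _; rewrite lee_fin expR_ge1Dx.
Qed.

(** A vanishing second moment forces [Z = 0], hence [expR Z = 1], almost everywhere. *)
Lemma centered_L2_expR_of_sqr0 (Z : T -> R) : centered_L2 Z ->
  ('E_P[fun w => (Z w ^+ 2)%R] = 0 -> 'E_P[fun w => expR (Z w)] = 1)%E.
Proof.
move=> [Z2 _]; have mZ := L2_measurable Z2; rewrite unlock => Z0.
have mZ2 : measurable_fun setT (fun w => (Z w ^+ 2)%:E).
  by apply/measurable_EFinP; exact: measurable_funX.
have /(ae_eq_integral_abs P measurableT mZ2) aeZ :
    (\int[P]_w `|(Z w ^+ 2)%:E| = 0)%E.
  by under eq_integral => w _ do rewrite gee0_abs ?lee_fin ?sqr_ge0//.
rewrite (ae_eq_integral (cst 1%E))//.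
- by rewrite (integral_cst P measurableT 1%E) mul1e; exact: probability_setT.
- by apply/measurable_EFinP; exact: measurableT_comp.
- apply: filterS aeZ => w /(_ I) /= [] /eqP; rewrite sqrf_eq0 => /eqP -> _.
  by rewrite expR0.
Qed.

(** * Expectations of products of independent variables *)

Definition independent_scalars (U V : T -> R) :=
  forall A B : set R, measurable A -> measurable B ->
    P (U @^-1` A `&` V @^-1` B) = (P (U @^-1` A) * P (V @^-1` B))%E.

Section Product.
Context (U V : {mfun T >-> R}).
Hypothesis iUV : independent_scalars U V.

Let W : T -> R * R := fun w => (U w, V w).
Let mW : measurable_fun setT W. Proof. exact: measurable_fun_pair. Qed.
HB.instance Definition _ := isMeasurableFun.Build _ _ _ _ W mW.

(** Independence is agreement of the two measures on measurable rectangles, and the product measure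
    is determined by its values there. *)
Lemma joint_distributionE (A : set (R * R)) : measurable A ->
  distribution P W A = (distribution P U \x distribution P V)%E A.
Proof.
by move=> mA; symmetry; apply: product_measure_unique.
Qed.

(** Tonelli's theorem under the joint law. Infinite expectations are allowed, as exponential moments
    may be infinite. *)
Lemma independent_ge0_expectation (f g : R -> R) :
  measurable_fun setT f -> measurable_fun setT g ->
  (forall x, 0 <= f x) -> (forall x, 0 <= g x) ->
  ('E_P[fun w => (f (U w) * g (V w))%R] =
  'E_P[fun w => f (U w)] * 'E_P[fun w => g (V w)])%E.
Proof.
move=> mf mg f0 g0; rewrite unlock.
pose h (z : R * R) := (f z.1 * g z.2)%:E.
have mh : measurable_fun setT h.
  apply/measurable_EFinP; apply: measurable_funM.
  - exact: measurableT_comp.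
  - exact: measurableT_comp.
have h0 z : (0 <= h z)%E by rewrite lee_fin mulr_ge0.
rewrite -[LHS](ge0_integral_distribution W mh h0).
rewrite (eq_measure_integral (distribution P U \x distribution P V)%E); last first.
  by move=> A mA _; exact: joint_distributionE.
rewrite fubini_tonelli1// /fubini_F.
have mf' : measurable_fun setT (EFin \o f) by exact/measurable_EFinP.
have mg' : measurable_fun setT (EFin \o g) by exact/measurable_EFinP.
have Eg : (\int[distribution P V]_y (EFin \o g) y =
    \int[P]_w (g (V w))%:E)%E.
  by rewrite ge0_integral_distribution// => y; rewrite lee_fin.
have Ef : (\int[distribution P U]_y (EFin \o f) y =
    \int[P]_w (f (U w))%:E)%E.
  by rewrite ge0_integral_distribution// => y; rewrite lee_fin.
rewrite -Eg -Ef -ge0_integralZr//; last 2 first.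
- by move=> x _; rewrite lee_fin.
- by apply: integral_ge0 => y _; rewrite lee_fin.
apply: eq_integral => x _.
rewrite -ge0_integralZl//; first by move=> y _; rewrite lee_fin.
by rewrite lee_fin.
Qed.

(** The integrand changes sign, so this is Fubini rather than Tonelli, with integrability coming
    from Hölder. The inner integral is [x] times the mean of [V], which is 0. *)
Lemma independent_expectation_mul0 :
  centered_L2 U -> centered_L2 V -> ('E_P[fun w => (U w * V w)%R] = 0)%E.
Proof.
move=> [U2 U0] [V2 V0]; rewrite unlock.
pose h (z : R * R) := (z.1 * z.2)%:E.
have mh : measurable_fun setT h.
  by apply/measurable_EFinP; apply: measurable_funM.
have ih : P.-integrable setT (h \o W).
  by apply/Lfun1_integrable; exact: (Lfun2_mul_Lfun1 U2 V2).
have eqm (A : set (R * R)) : measurable A -> A `<=` setT ->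
    distribution P W A = (distribution P U \x distribution P V)%E A.
  by move=> mA _; exact: joint_distributionE.
rewrite -[LHS](integral_distribution (X := W) mh ih).
rewrite (eq_measure_integral (distribution P U \x distribution P V)%E)//.
(* Integrability for the product measure is read off the joint law, where it is integrability of
   [U * V] under [P]. *)
rewrite -integral12_prod_meas1; last first.
  have /integrableP[_ hoo] := integrable_pushforward mW mh ih measurableT.
  apply/integrableP; split => //.
  rewrite (eq_measure_integral (distribution P W)); first exact: hoo.
  by move=> A mA As; symmetry; exact: eqm.
rewrite /fubini_F integral0_eq// => x _.
transitivity (\int[distribution P V]_y (x%:E * (y%:E)))%E; first by [].
have iV : P.-integrable setT (EFin \o V) by apply/Lfun1_integrable; exact: L2_L1.
rewrite integralZl//; last first.
  by apply: (integrable_pushforward _ _ iV) => //; exact/measurable_EFinP.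
rewrite (integral_distribution (X := V) (f := EFin))//.
by move: V0; rewrite unlock /comp /= => ->; rewrite mule0.
Qed.

End Product.

Lemma independent_expectation_expRD (U V : T -> R) :
  measurable_fun setT U -> measurable_fun setT V -> independent_scalars U V ->
  ('E_P[fun w => expR (U w + V w)%R] =
  'E_P[fun w => expR (U w)] * 'E_P[fun w => expR (V w)])%E.
Proof.
move=> mU mV iUV.
pose U' : {mfun T >-> R} := HB.pack U (isMeasurableFun.Build _ _ _ _ U mU).
pose V' : {mfun T >-> R} := HB.pack V (isMeasurableFun.Build _ _ _ _ V mV).
rewrite (_ : (fun w => expR (U w + V w)) = fun w => (expR (U w) * expR (V w))).
  by apply: (@independent_ge0_expectation U' V') => // x; exact: expR_ge0.
by apply/funext => w; rewrite expRD.
Qed.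

Lemma independent_expectation_sqrD (U V : T -> R) :
  centered_L2 U -> centered_L2 V -> independent_scalars U V ->
  ('E_P[fun w => ((U w + V w) ^+ 2)%R] =
  'E_P[fun w => (U w ^+ 2)%R] + 'E_P[fun w => (V w ^+ 2)%R])%E.
Proof.
move=> cU cV iUV; have [[U2 _] [V2 _]] := (cU, cV).
have [mU mV] := (L2_measurable U2, L2_measurable V2).
pose U' : {mfun T >-> R} := HB.pack U (isMeasurableFun.Build _ _ _ _ U mU).
pose V' : {mfun T >-> R} := HB.pack V (isMeasurableFun.Build _ _ _ _ V mV).
have UV0 := @independent_expectation_mul0 U' V' iUV cU cV.
have UV1 := Lfun2_mul_Lfun1 U2 V2.
have UU1 := Lfun2_mul_Lfun1 U2 U2.
have VV1 := Lfun2_mul_Lfun1 V2 V2.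
rewrite (_ : (fun w => (U w + V w) ^+ 2) =
    (U \* U \+ V \* V) \+ (U \* V \+ U \* V)); last first.
  by apply/funext => w /=; ring.
rewrite expectationD ?rpredD// expectationD//.
by rewrite [X in (_ + X)%E]expectationD// UV0 !adde0.
Qed.

End Scalars.

(** * Expectations depend only on the law *)

Section Laws.
Context (R : realType) dT (T : measurableType dT) (P : probability T R)
  dT' (T' : measurableType dT') (P' : probability T' R).

Lemma same_law_expectation (U : T -> R) (V : T' -> R) (f : R -> R) :
  measurable_fun setT U -> measurable_fun setT V ->
  (forall A : set R, measurable A -> P (U @^-1` A) = P' (V @^-1` A)) ->
  measurable_fun setT f -> (forall x, 0 <= f x) ->
  ('E_P[fun w => f (U w)] = 'E_P'[fun w => f (V w)])%E.
Proof.
move=> mU mV UV mf f0.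
pose U' : {mfun T >-> R} := HB.pack U (isMeasurableFun.Build _ _ _ _ U mU).
pose V' : {mfun T' >-> R} := HB.pack V (isMeasurableFun.Build _ _ _ _ V mV).
have mf' : measurable_fun setT (EFin \o f) by exact/measurable_EFinP.
have f0' y : (0 <= (EFin \o f) y)%E by rewrite lee_fin.
rewrite unlock -(ge0_integral_distribution U' mf' f0').
rewrite -(ge0_integral_distribution V' mf' f0').
by apply: eq_measure_integral => A mA _; exact: UV.
Qed.

End Laws.

(** * Projections of random vectors, admissible constants, and sums *)

Section Vectors.
Context (R : realType) (d : nat) dT (T : measurableType dT) (P : probability T R).
Implicit Types (X Y : T -> 'cV[R]_d) (t : 'cV[R]_d).

Lemma innerE t (x : 'cV[R]_d) : inner t x = \sum_(i < d) t i 0 * x i 0.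
Proof. by rewrite /inner mxE; apply: eq_bigr => i _; rewrite mxE. Qed.

(** It suffices to pull back open intervals; by continuity of the coordinate their preimages are
    open, so they are generators of [borel_cV]. *)
Lemma measurable_coord (i : 'I_d) :
  measurable_fun [set: borel_cV R d] (fun x : borel_cV R d => (x : 'cV[R]_d) i 0).
Proof.
apply: (measurability _ (RGenOpens.measurableE R)).
move=> _ [_ [a [b ->] <-]]; rewrite setTI; apply: sub_sigma_algebra.
have /continuousP := @coord_continuous R d 1 i 0.
by apply; exact: interval_open.
Qed.

Lemma measurable_inner t :
  measurable_fun [set: borel_cV R d] (fun x : borel_cV R d => inner t x).
Proof.
under eq_fun do rewrite innerE.
apply: measurable_sum => i; apply: measurable_funM; first exact: measurable_cst.
exact: measurable_coord.
Qed.

Lemma innerDr t (x y : 'cV[R]_d) : inner t (x + y) = inner t x + inner t y.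
Proof. by rewrite /inner mulmxDr mxE. Qed.

Lemma innerZl (s : R) t (x : 'cV[R]_d) : inner (s *: t) x = s * inner t x.
Proof. by rewrite /inner linearZ /= -scalemxAl mxE. Qed.

(** Measurability, centering and square integrability in coordinatewise form, which passes readily
    to sums, differences and linear images. *)
Definition centered_L2_vector X :=
  forall i, centered_L2 P (fun w => X w i 0).

Lemma centered_L2_vectorP X : random_vector X -> centered P X ->
  finite_second_moment P X -> centered_L2_vector X.
Proof.
move=> mX X0 X2 i.
have mXi j : measurable_fun setT (fun w => X w j 0).
  exact: (measurableT_comp (measurable_coord j) mX).
split; last exact: X0.
apply: sqr_integrable_L2 => //; apply: le_lt_trans X2.
rewrite unlock; apply: ge0_le_integral => //.
- by move=> w _; rewrite lee_fin sqr_ge0.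
- by apply/measurable_EFinP; exact: measurable_funX.
- by apply/measurable_EFinP; apply: measurable_sum => j; exact: measurable_funX.
- move=> w _; rewrite lee_fin (bigD1 i)//= lerDl.
  by apply: sumr_ge0 => j _; exact: sqr_ge0.
Qed.

Lemma centered_L2_inner X t :
  centered_L2_vector X -> centered_L2 P (fun w => inner t (X w)).
Proof.
move=> cX.
rewrite (_ : (fun _ => _) = fun w => \sum_(i < d) t i 0 * X w i 0); last first.
  by apply/funext => w; rewrite innerE.
exact: (@centered_L2_sum _ _ _ P d (fun i => t i 0) (fun i w => X w i 0)).
Qed.

Lemma centered_L2_vectorD X Y : centered_L2_vector X -> centered_L2_vector Y ->
  centered_L2_vector (fun w => X w + Y w).
Proof.
move=> cX cY i; rewrite (_ : (fun _ => _) = fun w => X w i 0 + Y w i 0).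
  exact: centered_L2D.
by apply/funext => w; rewrite mxE.
Qed.

Lemma centered_L2_vectorB X Y : centered_L2_vector X -> centered_L2_vector Y ->
  centered_L2_vector (fun w => X w - Y w).
Proof.
move=> cX cY i; rewrite (_ : (fun _ => _) = fun w => X w i 0 + -1 * Y w i 0).
  by apply: centered_L2D => //; exact: centered_L2Z.
by apply/funext => w; rewrite !mxE mulN1r.
Qed.

(** By bilinearity, the quadratic form of the covariance matrix is the covariance of [inner t X]
    with itself; symmetry reduces the second argument to the first. *)
Lemma directional_varianceE X t : centered_L2_vector X ->
  ((directional_variance P X t)%:E = 'E_P[fun w => (inner t (X w) ^+ 2)%R])%E.
Proof.
move=> cX; pose Z w := \sum_(i < d) t i 0 * X w i 0.
have cZ : centered_L2 P Z by exact: centered_L2_sum.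
rewrite (_ : (fun w => (inner t (X w)) ^+ 2) = fun w => Z w * Z w); last first.
  by apply/funext => w; rewrite innerE expr2.
rewrite -centered_L2_covariance// fine_covariance_suml//; congr EFin.
rewrite /directional_variance -mulmxA mxE; apply: eq_bigr => i _.
rewrite !mxE covarianceC fine_covariance_suml//; congr (_ * _).
by apply: eq_bigr => j _; rewrite mxE covarianceC mulrC.
Qed.

Lemma directional_variance_ge0 X t :
  centered_L2_vector X -> 0 <= directional_variance P X t.
Proof.
move=> cX; rewrite -lee_fin directional_varianceE//.
by apply: expectation_ge0 => w; exact: sqr_ge0.
Qed.

Lemma cgf_ge0 X t : centered_L2_vector X -> (0 <= cgf P X t)%E.
Proof.
by move=> cX; rewrite lne_ge0; apply: expectation_expR_ge1;
  exact: centered_L2_inner.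
Qed.

(** Removes the extended inverse from the range of [s]. For [c = 0] the inverse is infinite and both
    sides are true. *)
Lemma lt_inve_EFin (s c : R) : 0 <= s -> 0 <= c ->
  (s%:E < (c%:E)^-1)%E = (c * s < 1).
Proof.
move=> s0 c0; rewrite inver; case: eqVneq => [->|cn0].
  by rewrite mul0r ltr01 ltry.
have cp : 0 < c by rewrite lt_neqAle eq_sym cn0.
by rewrite lte_fin mulrC -(ltr_pdivlMr _ _ cp) div1r.
Qed.

(** Enlarging [c] shrinks both the range of [s] and the positive denominator, and the numerator is
    nonnegative. *)
Lemma radial_bound_le X t (c c' : R) : centered_L2_vector X -> 0 <= c ->
  c <= c' -> radial_bound P X t c -> radial_bound P X t c'.
Proof.
move=> cX c0 cc' b s s0; have c'0 := le_trans c0 cc'.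
rewrite lt_inve_EFin// => c's.
have cs : c * s <= c' * s by rewrite ler_wpM2r.
have cs1 : c * s < 1 by apply: le_lt_trans c's.
apply: le_trans (b s s0 _) _; first by rewrite lt_inve_EFin.
rewrite lee_fin ler_wpM2l ?mulr_ge0 ?directional_variance_ge0 ?sqr_ge0//.
rewrite lef_pV2 ?posrE; lra.
Qed.

Lemma radial_poleE X t : centered_L2_vector X ->
  radial_pole P X t =
  ereal_inf [set c%:E | c in [set c : R | 0 <= c /\ radial_bound P X t c]].
Proof.
move=> cX; rewrite /radial_pole; case: ltP => // V0.
have {}V0 : directional_variance P X t = 0.
  by apply/eqP; rewrite eq_le V0 directional_variance_ge0.
apply/eqP; rewrite eq_le; apply/andP; split.
  by apply: le_ereal_inf_tmp => _ [c [c0 _] <-]; rewrite lee_fin.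
(* With zero variance the constant 0 is admissible: the right side is 0, and so is the cumulant
   because the projection vanishes almost surely. *)
apply: ereal_inf_lbound; exists 0 => //; split=> // s s0 _.
rewrite V0 !mul0r /cgf; under eq_fun do rewrite innerZl.
rewrite (centered_L2_expR_of_sqr0 (Z := fun w => s * inner t (X w))).
- by rewrite lne1.
- by apply: centered_L2Z; exact: centered_L2_inner.
- rewrite (_ : (fun _ => _) = fun w => inner (s *: t) (X w) ^+ 2); last first.
    by apply/funext => w; rewrite innerZl.
  rewrite -directional_varianceE// /directional_variance.
  rewrite -scalemxAr [(s *: t)^T]linearZ /= -!scalemxAl mxE [X in _ * X]mxE.
  by rewrite -/(directional_variance P X t) V0 !mulr0.
Qed.

Lemma independent_inner X Y t :
  independent_vectors P X Y ->
  independent_scalars P (fun w => inner t (X w)) (fun w => inner t (Y w)).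
Proof.
move=> iXY A B mA mB.
have mi C : measurable C -> measurable ((inner t : borel_cV R d -> R) @^-1` C).
  by move=> mC; rewrite -[X in measurable X]setTI; exact: measurable_inner.
by have := iXY _ _ (mi A mA) (mi B mB).
Qed.

Lemma cgfD X Y t : centered_L2_vector X -> centered_L2_vector Y ->
  independent_vectors P X Y ->
  cgf P (fun w => X w + Y w) t = (cgf P X t + cgf P Y t)%E.
Proof.
move=> cX cY iXY; rewrite /cgf; under eq_fun do rewrite innerDr.
have [cX' cY'] := (centered_L2_inner t cX, centered_L2_inner t cY).
rewrite (@independent_expectation_expRD _ _ _ P (fun w => inner t (X w))
  (fun w => inner t (Y w))).
(* The logarithm turns products into sums on []0, +oo]], and both exponential moments are at least
   1. *)
- rewrite lneM// in_itv/= leey andbT.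
  + by apply: lt_le_trans (expectation_expR_ge1 cX').
  + by apply: lt_le_trans (expectation_expR_ge1 cY').
- exact: L2_measurable cX'.1.
- exact: L2_measurable cY'.1.
- exact: independent_inner.
Qed.

Lemma directional_varianceD X Y t :
  centered_L2_vector X -> centered_L2_vector Y -> independent_vectors P X Y ->
  directional_variance P (fun w => X w + Y w) t =
  directional_variance P X t + directional_variance P Y t.
Proof.
move=> cX cY iXY; apply/EFin_inj; rewrite EFinD.
rewrite !directional_varianceE//; last exact: centered_L2_vectorD.
under eq_fun do rewrite innerDr.
by apply: independent_expectation_sqrD;
  [exact: centered_L2_inner|exact: centered_L2_inner|exact: independent_inner].
Qed.

Lemma radial_poleD X Y t :
  centered_L2_vector X -> centered_L2_vector Y -> independent_vectors P X Y ->
  (radial_pole P (fun w => (X w + Y w)%R) t <=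
   maxe (radial_pole P X t) (radial_pole P Y t))%E.
Proof.
move=> cX cY iXY; rewrite !radial_poleE//; last exact: centered_L2_vectorD.
(* If the pole [S] of the sum exceeded both poles, there would be admissible [a, b < S]. But
   [Num.max a b] is admissible for the sum, a contradiction. Infinite poles need no separate
   case. *)
rewrite leNgt; apply/negP; rewrite gt_max => /andP[].
move=> /ereal_inf_lt[_ [a [a0 ba] <-] +] /ereal_inf_lt[_ [b [b0 bb] <-]].
set S := ereal_inf _ => aS bS.
suff : (S <= (Num.max a b)%:E)%E.
  by rewrite leNgt EFin_max gt_max aS bS.
have m0 : 0 <= Num.max a b by rewrite le_max a0.
apply: ereal_inf_lbound; exists (Num.max a b) => //; split=> // s s0 sm.
rewrite cgfD// directional_varianceD// mulrDl mulrDl EFinD leeD//.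
- by apply: (radial_bound_le (c := a)) => //; rewrite le_max lexx.
- by apply: (radial_bound_le (c := b)) => //; rewrite le_max lexx orbT.
Qed.

End Vectors.

(** * Cauchy's functional equation for nonnegative extended-real functions *)

Lemma additive_ge0_linear (R : realType) (f : R -> \bar R) :
  (forall r : R, 0 < r -> (0 <= f r)%E) ->
  (forall r s : R, 0 < r -> 0 < s -> (f (r + s)%R = f r + f s)%E) ->
  forall r : R, 0 < r -> (f r = r%:E * f 1%R)%E.
Proof.
move=> f0 fD.
have fM n (r : R) : 0 < r -> (f (n.+1%:R * r)%R = n.+1%:R%:E * f r)%E.
  move=> r0; elim: n => [|n IH]; first by rewrite mul1r mul1e.
  rewrite -[n.+2]addn1 natrD [in LHS]mulrDl mul1r fD ?mulr_gt0// IH.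
  by rewrite addrC EFinD ge0_muleDl ?mul1e ?lee_fin// addeC.
have f_le (r s : R) : 0 < r -> r <= s -> (f r <= f s)%E.
  move=> r0; rewrite le_eqVlt => /orP[/eqP->//|rs].
  have sr0 : 0 < s - r by rewrite subr_gt0.
  by rewrite -[s](subrKC r) fD// leeDl// f0.
move=> r r0.
(* Two Archimedean comparisons with 1: the first makes [f r] finite when [f 1] is finite, the second
   makes [f r] infinite when [f 1] is infinite. *)
have [n rn] : exists n, r <= n.+1%:R.
  exists (Num.trunc r); apply: ltW.
  by case/andP: (truncn_itv (ltW r0)).
have [m rm] : exists m, 1 <= m.+1%:R * r.
  exists (Num.trunc r^-1); rewrite -ler_pdivrMr// div1r; apply: ltW.
  by case/andP: (truncn_itv (ltW (etrans (invr_gt0 r) r0))).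
case E1 : (f 1) => [a| |]; last by have := f0 1 ltr01; rewrite E1.
- have a0 : 0 <= a by rewrite -lee_fin -E1 f0.
  have : f r \is a fin_num.
    rewrite ge0_fin_numE ?f0//; apply: le_lt_trans (f_le _ _ r0 rn) _.
    by rewrite -[n.+1%:R]mulr1 fM// E1 -EFinM ltry.
  case Er : (f r) => [b| |]// _; have b0 : 0 <= b by rewrite -lee_fin -Er f0.
  rewrite -EFinM; congr EFin; apply/eqP; rewrite -subr_eq0 -normr_le0.
  apply/ler_addgt0Pr => e e0; rewrite add0r.
  (* N f(r) = f(N r) and N r a both lie in [k a, (k + 1) a] for k = trunc (N r),
     so they differ by at most a. *)
  pose N := (Num.trunc (a / e)).+1.
  have Ngt : a / e < N%:R by case/andP: (truncn_itv (divr_ge0 a0 (ltW e0))).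
  have Nr0 : 0 < N%:R * r by rewrite mulr_gt0.
  have /andP[kl ku] := truncn_itv (ltW Nr0).
  have hu : N%:R * b <= (Num.trunc (N%:R * r)).+1%:R * a.
    have := f_le _ _ Nr0 (ltW ku).
    by rewrite fM// Er -[X in f X]mulr1 fM// E1 -!EFinM lee_fin.
  have hl : (Num.trunc (N%:R * r))%:R * a <= N%:R * b.
    (* Monotonicity is known only at positive arguments, so [k = 0] relies on [0 <= b] instead. *)
    move: kl; case: (Num.trunc _) => [|k] kl; first by rewrite mul0r mulr_ge0.
    have := f_le _ _ (ltr0Sn _ k) kl.
    by rewrite fM// Er -[X in f X]mulr1 fM// E1 -!EFinM lee_fin.
  have aNe : a < e * N%:R by rewrite mulrC -ltr_pdivrMr.
  have N0 : 0 < N%:R :> R by [].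
  (* Dividing by [N > a / e] leaves an error below [e]. *)
  suff : `|N%:R * (b - r * a)| <= a.
    rewrite normrM (ger0_norm (ltW N0)) => h.
    by rewrite -(ler_pM2l N0) (le_trans h)// mulrC ltW// mulrC.
  rewrite ler_norml; move: kl ku hu hl; set k := Num.trunc _ => kl ku hu hl.
  rewrite -natr1 in ku hu.
  have h1 : k%:R * a <= N%:R * r * a by rewrite ler_wpM2r.
  have h2 : N%:R * r * a <= (k%:R + 1) * a by rewrite ler_wpM2r// ltW.
  by apply/andP; split; lra.
- have : (m.+1%:R%:E * f r = +oo)%E.
    by apply/eqP; rewrite -leye_eq -E1 -fM// f_le.
  case: (f r) (f0 _ r0) => [b| |]//.
  by move=> _ _; rewrite gt0_muley.
Qed.

(** * Linear images, by passing to the transpose *)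

Lemma inner_mulmx (R : realType) (d m : nat) (L : 'M[R]_(m, d)) t x :
  inner t (L *m x) = inner (L^T *m t) x.
Proof. by rewrite /inner trmx_mul trmxK mulmxA. Qed.

Lemma radial_pole_mulmx (R : realType) dT (T : measurableType dT)
    (P : probability T R) (d m : nat) (X : T -> 'cV[R]_d) (L : 'M[R]_(m, d)) t :
  centered_L2_vector P X ->
  radial_pole P (fun w => L *m X w) t = radial_pole P X (L^T *m t).
Proof.
move=> cX.
have cLX : centered_L2_vector P (fun w => L *m X w).
  move=> i; rewrite (_ : (fun _ => _) = fun w => \sum_(j < d) L i j * X w j 0).
    exact: centered_L2_sum.
  by apply/funext => w; rewrite mxE.
have KE s : cgf P (fun w => L *m X w) (s *: t) = cgf P X (s *: (L^T *m t)).
  by rewrite /cgf scalemxAr; under eq_fun do rewrite inner_mulmx.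
have VE : directional_variance P (fun w => L *m X w) t =
    directional_variance P X (L^T *m t).
  apply: EFin_inj; rewrite !directional_varianceE//.
  by under eq_fun do rewrite inner_mulmx.
rewrite /radial_pole /radial_bound VE; case: ifP => // _.
congr ereal_inf; congr image; apply/funext => c; apply/propext.
by split=> -[c0 b]; split=> // s s0 sc; have := b s s0 sc; rewrite KE.
Qed.

(** * Lévy processes: additivity in time *)

Section Levy.
Context (R : realType) dT (T : measurableType dT) (P : probability T R) (d : nat)
  (L : R -> T -> 'cV[R]_d).
Hypothesis levyL : levy_process P L.
Hypothesis cL : forall r, 0 <= r -> centered_L2_vector P (L r).

(** Stationarity seen through a projection; it is applied with [f] the exponential and the
    square. *)
Lemma levy_increment_expectation (s r : R) (u : 'cV[R]_d) (f : R -> R) :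
  0 <= s -> 0 <= r -> measurable_fun setT f -> (forall x, 0 <= f x) ->
  ('E_P[fun w => f (inner u (L (s + r)%R w - L s w))] =
   'E_P[fun w => f (inner u (L r w))])%E.
Proof.
move=> s0 r0 mf f0.
apply: (same_law_expectation (U := fun w => inner u (L (s + r) w - L s w))
  (V := fun w => inner u (L r w))) => //.
- have := centered_L2_inner u
    (centered_L2_vectorB (cL (addr_ge0 s0 r0)) (cL s0)).
  by move=> /proj1/L2_measurable.
- exact: L2_measurable (centered_L2_inner u (cL r0)).1.
- move=> A mA.
  apply: (levy_stationary_increments levyL s0 r0
    (A := (inner u : borel_cV R d -> R) @^-1` A)).
  by rewrite -[X in measurable X]setTI; exact: measurable_inner.
Qed.

Lemma levy_increment_cgf (s r : R) (u : 'cV[R]_d) : 0 <= s -> 0 <= r ->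
  cgf P (fun w => L (s + r) w - L s w) u = cgf P (L r) u.
Proof.
by move=> s0 r0; congr lne; apply: levy_increment_expectation.
Qed.

Lemma levy_increment_variance (s r : R) (u : 'cV[R]_d) : 0 <= s -> 0 <= r ->
  directional_variance P (fun w => L (s + r) w - L s w) u =
  directional_variance P (L r) u.
Proof.
move=> s0 r0; apply: EFin_inj.
have cI := centered_L2_vectorB (cL (addr_ge0 s0 r0)) (cL s0).
rewrite (directional_varianceE u cI) (directional_varianceE u (cL r0)).
apply: (@levy_increment_expectation s r u (fun x => x ^+ 2)) => //.
by move=> x; exact: sqr_ge0.
Qed.

(** The first increment is written [L (0 + r) - L 0] so that stationarity at time 0 gives it the law
    of [L r]. *)
Lemma levy_increments_independent (r s : R) : 0 < r -> 0 < s ->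
  independent_vectors P (fun w => L (0 + r) w - L 0 w)
    (fun w => L (r + s) w - L r w).
Proof.
move=> r0 s0 A B mA mB.
(* The sampling times are 0, [r], [r + s]. The sequence is constant afterwards, as only two
   increments are used. *)
pose q (n : nat) : R := if n is n'.+1 then (if n' is _.+1 then r + s else r) else 0.
have q_lt i : (i < 2)%N -> q i < q i.+1.
  by case: i => [|[|]]//= _; rewrite ltrDl.
have := levy_independent_increments levyL (lexx (q 0)) q_lt.
move=> /(_ (fun i => if val i == 0 then A else B)) => iAB.
rewrite add0r; have {iAB} := iAB _.
rewrite big_ord_recl big_ord1 /= => <-; last by case=> -[|[|]].
congr (P _); apply/seteqP; split=> w /=.
  by move=> [Aw Bw] [[|[|]]//= i2] _.
by move=> h; split; [exact: (h ord0 I)|exact: (h ord_max I)].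
Qed.

Lemma levy_split (r s : R) :
  (fun w => L (0 + (r + s)) w - L 0 w) =
  (fun w => (L (0 + r) w - L 0 w) + (L (r + s) w - L r w)).
Proof. by apply/funext => w; rewrite !add0r [in RHS]addrC subrKA. Qed.

Lemma levy_cgfD (u : 'cV[R]_d) (r s : R) : 0 < r -> 0 < s ->
  cgf P (L (r + s)) u = (cgf P (L r) u + cgf P (L s) u)%E.
Proof.
move=> r0 s0; have rs0 := addr_gt0 r0 s0.
rewrite -(levy_increment_cgf u (lexx 0) (ltW rs0)) levy_split cgfD.
- by rewrite !levy_increment_cgf// ltW.
- by apply: centered_L2_vectorB; apply: cL => //; rewrite add0r ltW.
- by apply: centered_L2_vectorB; apply: cL; rewrite ltW.
- exact: levy_increments_independent.
Qed.

Lemma levy_varianceD (u : 'cV[R]_d) (r s : R) : 0 < r -> 0 < s ->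
  directional_variance P (L (r + s)) u =
  directional_variance P (L r) u + directional_variance P (L s) u.
Proof.
move=> r0 s0; have rs0 := addr_gt0 r0 s0.
rewrite -(levy_increment_variance u (lexx 0) (ltW rs0)) levy_split.
rewrite directional_varianceD.
- by rewrite !levy_increment_variance// ltW.
- by apply: centered_L2_vectorB; apply: cL => //; rewrite add0r ltW.
- by apply: centered_L2_vectorB; apply: cL; rewrite ltW.
- exact: levy_increments_independent.
Qed.

Lemma levy_radial_pole (r : R) (t : 'cV[R]_d) : 0 < r ->
  radial_pole P (L r) t = radial_pole P (L 1) t.
Proof.
move=> r0.
have KE u : (cgf P (L r) u = r%:E * cgf P (L 1) u)%E.
  apply: (@additive_ge0_linear R (fun r => cgf P (L r) u)) => //.
  - by move=> q q0; apply/cgf_ge0/cL/ltW.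
  - by move=> q s q0 s0; exact: levy_cgfD.
have VE : directional_variance P (L r) t = r * directional_variance P (L 1) t.
  apply: EFin_inj; rewrite EFinM.
  apply: (@additive_ge0_linear R
    (fun r => (directional_variance P (L r) t)%:E)) => //.
  - by move=> q q0; rewrite lee_fin; apply/directional_variance_ge0/cL/ltW.
  - by move=> q s q0 s0; rewrite levy_varianceD// EFinD.
rewrite /radial_pole VE pmulr_rgt0//; case: ifP => // _.
(* The finite positive factor [r] cancels from both sides, even when the cumulant is infinite, so
   the admissible constants coincide. *)
have bE c s : (cgf P (L r) (s *: t) <=
    (directional_variance P (L r) t * s ^+ 2 / (2 * (1 - c * s)))%:E)%E =
  (cgf P (L 1) (s *: t) <=
    (directional_variance P (L 1) t * s ^+ 2 / (2 * (1 - c * s)))%:E)%E.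
  by rewrite KE VE -!mulrA EFinM lee_pmul2l// mulrA.
congr ereal_inf; congr image; apply/funext => c; apply/propext.
by split=> -[c0 b]; split=> // s s0 sc; have := b s s0 sc; rewrite bE.
Qed.

End Levy.

Theorem proposition3p1 (R : realType) :
  (forall (dT : measure_display) (T : measurableType dT) (P : probability T R)
      (d m : nat) (X : T -> 'cV[R]_d) (L : 'M[R]_(m, d)) (t : 'cV[R]_m),
    centered_id_vector P X ->
    radial_pole P (fun w => L *m X w) t = radial_pole P X (L^T *m t))
  /\
  (forall (dT : measure_display) (T : measurableType dT) (P : probability T R)
      (d : nat) (X Y : T -> 'cV[R]_d) (t : 'cV[R]_d),
    centered_id_vector P X -> centered_id_vector P Y ->
    independent_vectors P X Y ->
    (radial_pole P (fun w => (X w + Y w)%R) t <=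
     maxe (radial_pole P X t) (radial_pole P Y t))%E)
  /\
  (forall (dT : measure_display) (T : measurableType dT) (P : probability T R)
      (d : nat) (L : R -> T -> 'cV[R]_d),
    levy_process P L ->
    (forall r : R, 0 <= r -> centered P (L r) /\ finite_second_moment P (L r)) ->
    forall (r : R) (t : 'cV[R]_d), 0 < r ->
      radial_pole P (L r) t = radial_pole P (L 1) t).
Proof.
split; [|split].
- move=> dT T P d m X L t [mX _ X0 X2].
  exact/radial_pole_mulmx/centered_L2_vectorP.
- move=> dT T P d X Y t [mX _ X0 X2] [mY _ Y0 Y2].
  by apply: radial_poleD; exact: centered_L2_vectorP.
- move=> dT T P d L levyL L2 r t; apply: levy_radial_pole => // q q0.
  have [q1 q2] := L2 q q0.
  by apply: centered_L2_vectorP => //; exact: (levy_random_vector levyL).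
Qed.
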